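(* Let $f:\mathbb{R}^n\to\mathbb{R}$ be differentiable and $\mu$-strongly convex with $L$-Lipschitz continuous gradient, where $0<\mu<L$, and let $g(x)=\sum_{i=1}^n g_i(x_i)$, where each $g_i:\mathbb{R}\to\mathbb{R}\cup\{+\infty\}$ is proper, convex and lower semi-continuous. Let $x^*$ be the (unique) minimizer of $f+g$ over $\mathbb{R}^n$, and assume that $x^*$ is nondegenerate. Let $\mathcal{Z}$ be the active-set and let $\delta$ be the minimum distance to the boundary of the subdifferential over $\mathcal{Z}$. Let $x^0\in\mathbb{R}^n$ and let $(x^k)_{k\ge 0}$ be generated by the proximal gradient method with a constant step-size $\alpha$ satisfying $0<\alpha<2/L$, and set $Q(\alpha)=\max\{|1-\alpha L|,|1-\alpha\mu|\}$. Then the active-set is identified after at most $\frac{1}{\log(1/Q(\alpha))}\log\left(3\|x^0-x^*\|/(\delta\alpha)\right)$ iterations; that is, for every integer $\bar k\ge 0$ with $$\bar k\ \ge\ \frac{1}{\log(1/Q(\alpha))}\log\left(\frac{3\|x^0-x^*\|}{\delta\alpha}\right),$$ we have $x_i^k=x_i^*$ for all $k>\bar k$ and all $i\in\mathcal{Z}$.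
   Context: $\|\cdot\|$ is the Euclidean norm, and $\log$ is the natural logarithm (with $\log 0=-\infty$). $\mu$-strong convexity: $f(y)\ge f(x)+\langle\nabla f(x),y-x\rangle+\frac{\mu}{2}\|y-x\|^2$ for all $x,y\in\mathbb{R}^n$. $L$-Lipschitz gradient: $\|\nabla f(y)-\nabla f(x)\|\le L\|y-x\|$ for all $x,y\in\mathbb{R}^n$. Proximal gradient method with step-size $\alpha>0$: $x^{k+1}=\mathrm{prox}_{\alpha g}\left(x^k-\alpha\nabla f(x^k)\right)$, where $\mathrm{prox}_{\alpha g}(x)=\operatorname{argmin}_{y}\left\{\frac12\|y-x\|^2+\alpha g(y)\right\}$. Subdifferential: for $x_i\in\operatorname{dom} g_i$, $\partial g_i(x_i)=\{v\in\mathbb{R}: g_i(y)\ge g_i(x_i)+v(y-x_i)\text{ for all }y\in\operatorname{dom} g_i\}$, which is an interval. When $\partial g_i(x_i^* )$ is not a singleton, write its interior as $(l_i,u_i)$ with $l_i\in\mathbb{R}\cup\{-\infty\}$ and $u_i\in\mathbb{R}\cup\{+\infty\}$. Nondegeneracy of $x^*$: for every $i$, $-\nabla_i f(x^* )=g_i'(x_i^* )$ if $\partial g_i(x_i^* )$ is a singleton ($g_i$ is then differentiable at $x_i^*$), and $-\nabla_i f(x^* )\in\operatorname{int}\partial g_i(x_i^* )$ if $\partial g_i(x_i^* )$ is not a singleton. Active-set: $\mathcal{Z}=\{i:\partial g_i(x_i^* )\text{ is not a singleton}\}$. $\delta=\min_{i\in\mathcal{Z}}\min\{-\nabla_i f(x^*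 )-l_i,\ u_i+\nabla_i f(x^* )\}$ (with value $+\infty$ allowed, in which case $1/\delta=0$). *)

(* Defs.v *)
From HB Require Import structures.
From mathcomp Require Import all_boot all_order all_algebra.
From mathcomp Require Import all_classical all_reals all_analysis.

Set Implicit Arguments.
Unset Strict Implicit.
Unset Printing Implicit Defensive.

Import Order.TTheory GRing.Theory Num.Theory.
Import numFieldNormedType.Exports.

Local Open Scope classical_set_scope.
Local Open Scope ring_scope.

Definition dotp (R : realType) (n : nat) (u v : 'rV[R]_n) : R :=
  \sum_(i < n) u 0 i * v 0 i.

(* The library norm `|x| on 'rV[R]_n is the max norm; it induces the same
   topology and the same notion of differentiability. *)
Definition enorm (R : realType) (n : nat) (u : 'rV[R]_n) : R :=
  Num.sqrt (dotp u u).

Definition grad (R : realType) (n : nat) (f : 'rV[R]_n -> R) (x : 'rV[R]_n) :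
    'rV[R]_n :=
  \row_(i < n) 'D_(delta_mx 0 i : 'rV[R]_n) f x.

Definition strongly_convex (R : realType) (n : nat) (mu : R)
    (f : 'rV[R]_n -> R) : Prop :=
  forall x y, f x + dotp (grad f x) (y - x) + mu / 2 * enorm (y - x) ^+ 2 <= f y.

Definition lipschitz_grad (R : realType) (n : nat) (L : R)
    (f : 'rV[R]_n -> R) : Prop :=
  forall x y, enorm (grad f y - grad f x) <= L * enorm (y - x).

Definition edom (R : realType) (T : Type) (h : T -> \bar R) : set T :=
  [set t | (h t < +oo)%E].

Definition eproper (R : realType) (h : R -> \bar R) : Prop :=
  (forall t, (-oo < h t)%E) /\ edom h !=set0.

Definition econvex (R : realType) (h : R -> \bar R) : Prop :=
  forall (s t a : R), 0 <= a <= 1 ->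
    (h (a * s + (1 - a) * t)%R <= a%:E * h s + (1 - a)%:E * h t)%E.

Definition separable_sum (R : realType) (n : nat) (g : 'I_n -> R -> \bar R)
    (x : 'rV[R]_n) : \bar R :=
  (\sum_(i < n) g i (x 0%R i))%E.

Definition argmin (R : realType) (T : Type) (F : T -> \bar R) : set T :=
  [set p | forall y, (F p <= F y)%E].

(* The set of minimizers; [p = prox_(alpha g)(x)] is rendered as membership of
   [p], the minimizer being unique when alpha > 0 and g is a sum of proper
   convex lower semicontinuous functions of the coordinates. *)
Definition prox (R : realType) (n : nat) (alpha : R) (g : 'rV[R]_n -> \bar R)
    (x : 'rV[R]_n) : set 'rV[R]_n :=
  argmin (fun y => ((1 / 2 * enorm (y - x) ^+ 2)%:E + alpha%:E * g y)%E).

Definition proximal_gradient (R : realType) (n : nat) (alpha : R)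
    (f : 'rV[R]_n -> R) (g : 'rV[R]_n -> \bar R) (x : nat -> 'rV[R]_n) : Prop :=
  forall k, prox alpha g (x k - alpha *: grad f (x k)) (x k.+1).

(* Meaningful for t in [edom h]. *)
Definition subdiff (R : realType) (h : R -> \bar R) (t : R) : set R :=
  [set v | forall y, edom h y -> (h t + (v * (y - t))%:E <= h y)%E].

Definition is_singleton (T : Type) (A : set T) : Prop := exists a, A = [set a].

(* When the subdifferential of a proper convex h at t in [edom h] is a
   singleton, t is interior to [edom h], so [fine \o h] coincides with h near t
   and its derivative at t is that of h. *)
Definition nondegenerate_min (R : realType) (n : nat) (f : 'rV[R]_n -> R)
    (g : 'I_n -> R -> \bar R) (xs : 'rV[R]_n) : Prop :=
  forall i,
    (is_singleton (subdiff (g i) (xs 0 i)) ->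
       - grad f xs 0 i = derive1 (fine \o g i) (xs 0 i)) /\
    (~ is_singleton (subdiff (g i) (xs 0 i)) ->
       (subdiff (g i) (xs 0 i))^° (- grad f xs 0 i)).

Definition active_set (R : realType) (n : nat) (g : 'I_n -> R -> \bar R)
    (xs : 'rV[R]_n) : set 'I_n :=
  [set i | ~ is_singleton (subdiff (g i) (xs 0 i))].

(* Endpoints of the interior of the subdifferential, an open interval, which is
   nonempty at the active coordinates of a nondegenerate minimizer. *)
Definition subdiff_lo (R : realType) (h : R -> \bar R) (t : R) : \bar R :=
  ereal_inf (EFin @` (subdiff h t)^°).

Definition subdiff_hi (R : realType) (h : R -> \bar R) (t : R) : \bar R :=
  ereal_sup (EFin @` (subdiff h t)^°).

(* Extended-valued; it is +oo when the minimum is over the empty set or all the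
   endpoints involved are infinite, and then [inve +oo = 0] and [lne 0 = -oo]. *)
Definition subdiff_gap (R : realType) (n : nat) (f : 'rV[R]_n -> R)
    (g : 'I_n -> R -> \bar R) (xs : 'rV[R]_n) : \bar R :=
  (\big[mine/+oo]_(i < n | i \in active_set g xs)
     mine ((- grad f xs 0 i)%:E - subdiff_lo (g i) (xs 0%R i))
          (subdiff_hi (g i) (xs 0%R i) + (grad f xs 0 i)%:E))%E.

Definition contraction_factor (R : realType) (alpha L mu : R) : R :=
  Num.max `|1 - alpha * L| `|1 - alpha * mu|.

(* Main.v *)
(* The forward step x - alpha grad f(x) is a Q-contraction by cocoercivity of
   grad f, and the backward step is firmly nonexpansive coordinate by coordinate,
   since the subdifferential of each g_i is monotone; hence |x^k - x*| <=
   Q^k |x^0 - x*|. The optimality condition of the proximal step produces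
   subgradients of g_i at x_i^(k+1) lying within Q^(k+1) |x^0 - x*| / alpha of
   - grad_i f at x*. Once this distance is less than delta, such a subgradient lies
   strictly between two subgradients of g_i at x*_i, and monotonicity forces
   x_i^(k+1) = x*_i. *)
Require Import Defs.
From HB Require Import structures.
From mathcomp Require Import all_boot all_order all_algebra.
From mathcomp Require Import all_classical all_reals all_analysis.
From mathcomp Require Import ring lra.

Set Implicit Arguments.
Unset Strict Implicit.
Unset Printing Implicit Defensive.

Import Order.TTheory GRing.Theory Num.Theory.
Import numFieldNormedType.Exports.

Local Open Scope classical_set_scope.
Local Open Scope ring_scope.

(** * Euclidean inner product and norm *)

Section InnerProduct.
Variables (R : realType) (n : nat).
Implicit Types (u v w : 'rV[R]_n) (a : R).

Lemma dotpC u v : dotp u v = dotp v u.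
Proof. by apply: eq_bigr => i _; rewrite mulrC. Qed.

Lemma dotpDl u v w : dotp (u + v) w = dotp u w + dotp v w.
Proof. by rewrite -big_split; apply: eq_bigr => i _; rewrite mxE mulrDl. Qed.

Lemma dotpDr u v w : dotp w (u + v) = dotp w u + dotp w v.
Proof. by rewrite dotpC dotpDl !(dotpC w). Qed.

Lemma dotpZl a u v : dotp (a *: u) v = a * dotp u v.
Proof. by rewrite mulr_sumr; apply: eq_bigr => i _; rewrite mxE mulrA. Qed.

Lemma dotpZr a u v : dotp u (a *: v) = a * dotp u v.
Proof. by rewrite dotpC dotpZl dotpC. Qed.

Lemma dotpNl u v : dotp (- u) v = - dotp u v.
Proof. by rewrite -scaleN1r dotpZl mulN1r. Qed.

Lemma dotpNr u v : dotp u (- v) = - dotp u v.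
Proof. by rewrite dotpC dotpNl dotpC. Qed.

Definition dotpE := (dotpDl, dotpDr, dotpNl, dotpNr, dotpZl, dotpZr).

Lemma dotp_ge0 u : 0 <= dotp u u.
Proof. by apply: sumr_ge0 => i _; exact: sqr_ge0. Qed.

Lemma dotp_delta u i : dotp u (delta_mx 0 i) = u 0 i.
Proof.
rewrite /dotp (bigD1 i) //= big1 => [|j ji].
  by rewrite mxE !eqxx mulr1 addr0.
by rewrite mxE (negPf ji) andbF mulr0.
Qed.

Lemma enorm_ge0 u : 0 <= enorm u.
Proof. exact: sqrtr_ge0. Qed.

Lemma enormE u : enorm u ^+ 2 = dotp u u.
Proof. by rewrite sqr_sqrtr // dotp_ge0. Qed.

Lemma coord_le_enorm u i : `|u 0 i| <= enorm u.
Proof.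
rewrite -sqrtr_sqr ler_wsqrtr // /dotp (bigD1 i) //= expr2 lerDl.
by apply: sumr_ge0 => j _; exact: sqr_ge0.
Qed.

Lemma enorm_le_dotp a u v : 0 <= a ->
  (enorm u <= a * enorm v) = (dotp u u <= a ^+ 2 * dotp v v).
Proof.
move=> a0; rewrite -ler_sqr ?nnegrE ?mulr_ge0 ?enorm_ge0 //.
by rewrite exprMn !enormE.
Qed.

(** Expanding 0 <= |u - a v|^2 gives 2a <u, v> <= |u|^2 + a^2 |v|^2 <= 2a^2 |v|^2, which takes the
    place of Cauchy-Schwarz. *)
Lemma dotp_le_enorm a u v : 0 < a -> enorm u <= a * enorm v ->
  dotp u v <= a * dotp v v.
Proof.
move=> a0; rewrite (enorm_le_dotp _ _ (ltW a0)) => le_uv.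
have := dotp_ge0 (u - a *: v); rewrite !dotpE (dotpC v u) => h.
rewrite -(ler_pM2l a0); lra.
Qed.

End InnerProduct.

(** * Contraction of the gradient step *)

Section Contraction.
Variables (R : realType) (n : nat) (f : 'rV[R]_n -> R) (mu L : R).
Hypotheses (mu_gt0 : 0 < mu) (mu_lt_L : mu < L).
Hypotheses (f_sc : strongly_convex mu f) (f_lip : lipschitz_grad L f).

Let L_gt0 : 0 < L. Proof. exact: lt_trans mu_lt_L. Qed.

(* Splitting the segment at its midpoint turns an upper bound with constant C
   into one with constant C / 2 + L / 4, whose fixed point is L / 2. *)
Lemma descent_lemma_approx k x v :
  f (x + v) <= f x + dotp (grad f x) v + (L / 2 + L / 2 * 2^-1 ^+ k) * dotp v v.
Proof.
elim: k x v => [|k IHk] x v.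
  (* Strong convexity based at x + v bounds f (x + v) through the gradient there; the Lipschitz
     condition moves that gradient to x, giving the constant L = L / 2 + L / 2. *)
  have := f_sc (x + v) x; have := f_lip x (x + v).
  rewrite enormE (addrC x) addrK => /(dotp_le_enorm L_gt0).
  rewrite opprD (addrC (- v)) addrA subrr add0r !dotpE => h1.
  have := mulr_ge0 (ltW mu_gt0) (dotp_ge0 v); rewrite expr0; lra.
set w := 2^-1 *: v.
have vE : v = w + w.
  by rewrite -mulr2n -scaler_nat scalerA divff ?scale1r ?pnatr_eq0.
have := IHk x w; have := IHk (x + w) w; have := f_lip x (x + w).
rewrite (addrC x) addrK (addrC w) => /(dotp_le_enorm L_gt0).
rewrite -addrA -vE; rewrite vE !dotpE exprS; set s := _ ^+ k; set t := dotp w w.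
by lra.
Qed.

(** Obtained by letting k tend to infinity in [descent_lemma_approx], in place of integrating along
    the segment. *)
Lemma descent_lemma x v :
  f (x + v) <= f x + dotp (grad f x) v + L / 2 * dotp v v.
Proof.
have cvg_rhs : (fun k => f x + dotp (grad f x) v +
    (L / 2 + L / 2 * 2^-1 ^+ k) * dotp v v) @ \oo -->
    f x + dotp (grad f x) v + (L / 2 + L / 2 * 0) * dotp v v.
  apply: cvgD; first exact: cvg_cst.
  apply: cvgMl; apply: cvgD; first exact: cvg_cst.
  by apply: cvgMr; apply: cvg_expr; rewrite ger0_norm ?invf_lt1 ?ltr1n ?invr_ge0.
rewrite mulr0 addr0 in cvg_rhs.
rewrite -(cvg_lim _ cvg_rhs) //; apply: limr_ge.
  by apply/cvg_ex; eexists; exact: cvg_rhs.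
by apply: nearW => k; exact: descent_lemma_approx.
Qed.

(** This is the interpolation inequality for the convex, (L - mu)-smooth function f - mu/2 |.|^2,
    whose gradient increment is e - mu d. *)
Lemma bregman_ge x d e : grad f (x + d) = grad f x + e ->
  (L - mu) * (mu * dotp d d) + dotp (e - mu *: d) (e - mu *: d) <=
  2 * (L - mu) * (f (x + d) - f x - dotp (grad f x) d).
Proof.
move=> grad_xd; have Lmu : 0 < L - mu by rewrite subr_gt0.
(* [w] maximizes the gap between the lower bound at [x] and the upper bound
   at [x + d], both evaluated at [x + d - w]. *)
have [w rE] : exists w, e - mu *: d = (L - mu) *: w.
  exists ((L - mu)^-1 *: (e - mu *: d)).
  by rewrite scalerA divff ?gt_eqF // scale1r.
have := descent_lemma (x + d) (- w); have := f_sc x (x + d - w).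
have -> : x + d - w - x = d - w by rewrite addrAC (addrC x) addrK.
rewrite grad_xd enormE -[e](subrK (mu *: d)) rE addrK.
rewrite !dotpE (dotpC w d).
move: (dotp d d) (dotp d w) (dotp w w) (dotp _ d) (dotp _ w) => dd dw ww gd gw.
move=> h1 h2.
have : 0 <= (L - mu) * (f (x + d) - f x - gd - mu / 2 * dd - (L - mu) / 2 * ww).
  by apply: mulr_ge0; [exact: ltW|lra].
by lra.
Qed.

(** [bregman_ge] is applied from x to x + d and back; on adding, the function values cancel. *)
Lemma grad_cocoercive x d e : grad f (x + d) = grad f x + e ->
  dotp e e + mu * L * dotp d d <= (mu + L) * dotp e d.
Proof.
move=> grad_xd; have := bregman_ge grad_xd.
have grad_x : grad f (x + d - d) = grad f (x + d) - e.
  by rewrite grad_xd !addrK.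
have := bregman_ge grad_x; have Lmu : 0 < L - mu by rewrite subr_gt0.
rewrite grad_xd !addrK !dotpE (dotpC d e).
move: (dotp d d) (dotp e d) (dotp e e) (dotp (grad f x) d) => dd ed ee gd h1 h2.
rewrite -(ler_pM2l Lmu); nra.
Qed.

(** Cocoercivity bounds |d - alpha e|^2 by an expression affine in <e, d>, which lies in
    [mu |d|^2, L |d|^2]; the endpoints give (1 - alpha mu)^2 |d|^2 and (1 - alpha L)^2 |d|^2. *)
Lemma gradient_step_contraction alpha x y : 0 < alpha ->
  enorm ((y - alpha *: grad f y) - (x - alpha *: grad f x)) <=
  contraction_factor alpha L mu * enorm (y - x).
Proof.
move=> a0; set Q := contraction_factor alpha L mu.
have Q0 : 0 <= Q by rewrite le_max normr_ge0.
have QL : (1 - alpha * L) ^+ 2 <= Q ^+ 2.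
  by rewrite -real_normK ?num_real // ler_sqr ?nnegrE // le_max lexx.
have Qmu : (1 - alpha * mu) ^+ 2 <= Q ^+ 2.
  by rewrite -real_normK ?num_real // ler_sqr ?nnegrE // le_max lexx orbT.
rewrite enorm_le_dotp //.
have [d yE] : exists d, y = x + d by exists (y - x); rewrite addrC subrK.
have [e eE] : exists e, grad f y = grad f x + e.
  by exists (grad f y - grad f x); rewrite addrC subrK.
have xd : x + d - x = d by rewrite addrC addKr.
have coco : dotp e e + mu * L * dotp d d <= (mu + L) * dotp e d.
  by apply: (@grad_cocoercive x); rewrite -yE.
have b_ge : mu * dotp d d <= dotp e d.
  have := f_sc x y; have := f_sc y x.
  rewrite !enormE eE yE xd opprD addrA subrr add0r !dotpE; lra.
have b_le : dotp e d <= L * dotp d d.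
  have := f_lip x y; rewrite eE yE xd (addrC _ e) addrK.
  exact: dotp_le_enorm.
have -> : y - alpha *: grad f y - (x - alpha *: grad f x) = d - alpha *: e.
  rewrite eE yE scalerDr !opprD opprK.
  by rewrite [RHS]addrC; apply/rowP => i; rewrite !mxE; ring.
rewrite {1 2}yE xd.
have dd0 := dotp_ge0 d.
have QLd := ler_wpM2r dd0 QL; have Qmud := ler_wpM2r dd0 Qmu.
rewrite !dotpE (dotpC d e).
have a2 : 0 <= alpha ^+ 2 * ((mu + L) * dotp e d - dotp e e - mu * L * dotp d d).
  by apply: mulr_ge0; [exact: sqr_ge0|lra].
(* The sign of 2 - alpha (mu + L) decides which endpoint is the worst case. *)
case: (lerP (alpha * (mu + L)) 2) => h.
  apply: le_trans Qmud.
  have : 0 <= alpha * ((2 - alpha * (mu + L)) * (dotp e d - mu * dotp d d)).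
    by apply: mulr_ge0; [exact: ltW|apply: mulr_ge0; lra].
  by lra.
apply: le_trans QLd.
have : 0 <= alpha * ((alpha * (mu + L) - 2) * (L * dotp d d - dotp e d)).
  by apply: mulr_ge0; [exact: ltW|apply: mulr_ge0; lra].
by lra.
Qed.

End Contraction.

(** Since mu < L, 1 - alpha L and 1 - alpha mu cannot both vanish; this gives positivity, used when
    taking [ln (1 / q)]. *)
Lemma contraction_factor_bounds (R : realType) (alpha L mu : R) :
  0 < mu -> mu < L -> 0 < alpha -> alpha < 2 / L ->
  0 < contraction_factor alpha L mu < 1.
Proof.
move=> mu0 muL a0; rewrite (ltr_pdivlMr _ _ (lt_trans mu0 muL)) => aL.
have aL0 := mulr_gt0 a0 mu0.
have amuL : alpha * mu < alpha * L by rewrite ltr_pM2l.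
rewrite lt_max gt_max !normr_gt0 !ltr_norml; apply/andP; split.
  by case: eqP => //= h; apply/eqP; lra.
by apply/andP; split; lra.
Qed.

(** * Monotonicity of the subdifferential on the line *)

Section Subdifferential.
Variable R : realType.
Implicit Types (h : R -> \bar R) (s t u v a b : R).

Lemma proper_fin_num h t : eproper h -> edom h t -> h t \is a fin_num.
Proof. by move=> [hN _] ht; rewrite fin_real // hN. Qed.

Lemma subdiff_monotone h s t u v : eproper h -> edom h s -> edom h t ->
  subdiff h s u -> subdiff h t v -> 0 <= (u - v) * (s - t).
Proof.
move=> h_proper hs ht su sv.
have := sv _ hs; have := su _ ht.
rewrite -(fineK (proper_fin_num h_proper hs)).
rewrite -(fineK (proper_fin_num h_proper ht)).
by rewrite -!EFinD !lee_fin; lra.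
Qed.

(** Monotonicity against a gives t <= s, and against b gives s <= t. *)
Lemma subdiff_between_eq h s t u a b : eproper h -> edom h s -> edom h t ->
  subdiff h s u -> subdiff h t a -> subdiff h t b -> a < u -> u < b -> s = t.
Proof.
move=> h_proper hs ht su sa sb; rewrite -subr_gt0 => au; rewrite -subr_lt0 => ub.
have := subdiff_monotone h_proper hs ht su sa.
have := subdiff_monotone h_proper hs ht su sb.
rewrite (pmulr_rge0 _ au) (nmulr_rge0 _ ub) => h1 h2; lra.
Qed.

End Subdifferential.

(** Serves to let a step length s tend to 0 after dividing a first-order inequality by s. *)
Lemma le0_of_le_small (R : realFieldType) (X K : R) :
  (forall s, 0 < s <= 1 -> X <= s * K) -> X <= 0.
Proof.
move=> h; rewrite leNgt; apply/negP => X0.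
have D0 : 0 < X + `|K| + 1 by have := normr_ge0 K; lra.
(* For this s, X <= s * K would force X + |K| + 1 <= K. *)
have /h : 0 < X / (X + `|K| + 1) <= 1.
  by rewrite divr_gt0 //= ler_pdivrMr // mul1r; have := normr_ge0 K; lra.
rewrite mulrAC ler_pdivlMr // ler_pM2l // => hK.
by have := ler_norm K; lra.
Qed.

(** * First-order optimality for a smooth term plus a separable sum *)

Section SeparableOptimality.
Variables (R : realType) (n : nat) (g : 'I_n -> R -> \bar R).
Hypotheses (g_proper : forall i, eproper (g i)).
Hypotheses (g_convex : forall i, econvex (g i)).

Lemma separable_sum_edom (p : 'rV[R]_n) : (separable_sum g p < +oo)%E ->
  forall i, edom (g i) (p 0 i).
Proof.
move=> gp i; rewrite /edom /= ltey; apply: contraTneq gp => gi.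
rewrite -leNgt leye_eq /separable_sum esum_eqy => [|j _].
  by apply/existsP; exists i; rewrite gi eqxx.
by have [gN _] := g_proper j; rewrite gt_eqF.
Qed.

Lemma separable_sum_fin_num (p : 'rV[R]_n) :
  (forall i, edom (g i) (p 0 i)) -> separable_sum g p \is a fin_num.
Proof.
by move=> gp; apply/sum_fin_numP => i _ _; exact: proper_fin_num.
Qed.

Variables (h : 'rV[R]_n -> R) (a C : R) (p G : 'rV[R]_n).
Hypothesis a_gt0 : 0 < a.
(** A quadratic upper model at p with slope G covers both uses: h = f at [xs] with C = L / 2, and
    the proximal quadratic with C = 1 / 2. *)
Hypothesis h_upper : forall v, h (p + v) <= h p + dotp G v + C * dotp v v.
Hypothesis p_min : argmin (fun y => ((h y)%:E + a%:E * separable_sum g y)%E) p.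

(** Properness provides a point of finite value, and p does at least as well. *)
Lemma argmin_edom i : edom (g i) (p 0 i).
Proof.
have [y gy] : exists y : 'rV[R]_n, forall i, edom (g i) (y 0 i).
  have /choice[y gy] : forall i, exists t, edom (g i) t.
    by move=> j; have [] := g_proper j.
  by exists (\row_j y j) => j; rewrite mxE.
apply: separable_sum_edom; have := p_min y.
rewrite -(fineK (separable_sum_fin_num gy)) -EFinM -EFinD.
move=> /le_lt_trans/(_ (ltry _)).
case: (separable_sum g p) => [r| |] //; first by rewrite !ltry.
by rewrite gt0_muley ?lte_fin.
Qed.

(** Coordinate i of p is moved a fraction s of the way to t. By convexity g_i changes by at most s
    times its full change, and the quadratic error is C s^2 d^2; dividing by s and letting s tend to
    0 leaves the subgradient inequality. *)
Lemma argmin_subdiff i : subdiff (g i) (p 0 i) (- G 0 i / a).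
Proof.
move=> t gt; have gp := argmin_edom.
rewrite -(fineK (proper_fin_num (g_proper i) gt)).
rewrite -(fineK (proper_fin_num (g_proper i) (gp i))).
rewrite -EFinD lee_fin.
set r0 := fine (g i (p 0 i)); set r1 := fine (g i t); set d := t - p 0 i.
suff : a * (r0 - r1) - G 0 i * d <= 0.
  move=> hX; rewrite -(ler_pM2l a_gt0).
  have -> : a * (r0 + - G 0 i / a * d) = a * r0 - G 0 i * d.
    by field; rewrite gt_eqF.
  by lra.
apply: (@le0_of_le_small _ _ (C * d ^+ 2)) => s /andP[s0 s1].
set T := s * t + (1 - s) * p 0 i.
pose y := p + (s * d) *: delta_mx 0 i.
have yi : y 0 i = T by rewrite !mxE !eqxx mulr1 /T /d; ring.
have yj j : j != i -> y 0 j = p 0 j.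
  by move=> /negPf ji; rewrite !mxE ji andbF mulr0 addr0.
have gT : (g i T <= (s * r1 + (1 - s) * r0)%:E)%E.
  have s01 : 0 <= s <= 1 by rewrite ltW.
  apply: le_trans (@g_convex i t (p 0 i) s s01) _.
  rewrite -(fineK (proper_fin_num (g_proper i) gt)).
  by rewrite -(fineK (proper_fin_num (g_proper i) (gp i))).
have gTfin : edom (g i) T by rewrite /edom /= (le_lt_trans gT) ?ltry.
(* The untouched coordinates contribute a finite sum, so it cancels from the comparison of p with
   y. *)
have rest_fin : (\sum_(j < n | j != i) g j (p 0%R j))%E \is a fin_num.
  by apply/sum_fin_numP => j _ _; exact: proper_fin_num.
have sum_split q : separable_sum g q =
    (g i (q 0%R i) + \sum_(j < n | j != i) g j (q 0%R j))%E.
  by rewrite /separable_sum (bigD1 i).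
have sum_y : separable_sum g y =
    (g i T + \sum_(j < n | j != i) g j (p 0%R j))%E.
  by rewrite sum_split yi; congr adde; apply: eq_bigr => j ji; rewrite yj.
have := p_min y; rewrite sum_y sum_split.
rewrite -(fineK rest_fin) -(fineK (proper_fin_num (g_proper i) gTfin)).
rewrite -(fineK (proper_fin_num (g_proper i) (gp i))) -/r0.
rewrite -(fineK (proper_fin_num (g_proper i) gTfin)) lee_fin in gT.
rewrite -!EFinD lee_fin.
have := h_upper ((s * d) *: delta_mx 0 i).
rewrite -/y !dotpE !dotp_delta mxE !eqxx /=.
move: (fine _) gT (fine _) (h y) => rT gT rho hy h1 h2.
rewrite -(ler_pM2l s0).
have := ler_wpM2l (ltW a_gt0) gT; lra.
Qed.

End SeparableOptimality.

Lemma le_enorm (R : realType) (n : nat) (u v : 'rV[R]_n) :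
  (forall i, `|u 0 i| <= `|v 0 i|) -> enorm u <= enorm v.
Proof.
move=> uv; apply: ler_wsqrtr; apply: ler_sum => i _.
rewrite -!expr2 -[u 0 i ^+ 2]real_normK ?num_real //.
by rewrite -[v 0 i ^+ 2]real_normK ?num_real // ler_sqr ?nnegrE.
Qed.

(** * Linear convergence and identification for the proximal gradient iteration *)

Section ProximalGradient.
Variables (R : realType) (n : nat) (f : 'rV[R]_n -> R) (g : 'I_n -> R -> \bar R).
Variables (mu L alpha : R) (xs : 'rV[R]_n) (x : nat -> 'rV[R]_n).
Hypotheses (mu_gt0 : 0 < mu) (mu_lt_L : mu < L).
Hypotheses (f_sc : strongly_convex mu f) (f_lip : lipschitz_grad L f).
Hypotheses (g_proper : forall i, eproper (g i)).
Hypotheses (g_convex : forall i, econvex (g i)).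
Hypothesis xs_min : argmin (fun y => ((f y)%:E + separable_sum g y)%E) xs.
Hypothesis alpha_gt0 : 0 < alpha.
Hypothesis x_pgm : proximal_gradient alpha f (separable_sum g) x.

Local Notation Q := (contraction_factor alpha L mu).

Let xs_min1 : argmin (fun y => ((f y)%:E + 1%:E * separable_sum g y)%E) xs.
Proof. by move=> y /=; rewrite !mul1e; exact: xs_min. Qed.

Let f_upper := @descent_lemma _ _ _ _ _ mu_gt0 mu_lt_L f_sc f_lip xs.

Lemma minimizer_edom i : edom (g i) (xs 0 i).
Proof. exact: (argmin_edom g_proper ltr01 xs_min1). Qed.

Lemma minimizer_subdiff i : subdiff (g i) (xs 0 i) (- grad f xs 0 i).
Proof.
have := argmin_subdiff g_proper g_convex ltr01 f_upper xs_min1 (i := i).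
by rewrite divr1.
Qed.

(** In fact an equality; the form matches [h_upper] with slope p - w. *)
Lemma prox_upper (w p v : 'rV[R]_n) :
  1 / 2 * enorm (p + v - w) ^+ 2 <=
  1 / 2 * enorm (p - w) ^+ 2 + dotp (p - w) v + 1 / 2 * dotp v v.
Proof.
by rewrite addrAC !enormE [dotp (p - w + v) _]dotpDl !(dotpDr _ v) (dotpC v); lra.
Qed.

Lemma pgm_edom k i : edom (g i) (x k.+1 0 i).
Proof. exact: (argmin_edom g_proper alpha_gt0 (x_pgm k)). Qed.

Lemma pgm_subdiff k i :
  subdiff (g i) (x k.+1 0 i)
    ((x k - alpha *: grad f (x k) - x k.+1) 0 i / alpha).
Proof.
have := argmin_subdiff g_proper g_convex alpha_gt0 (prox_upper _ _) (x_pgm k)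
  (i := i).
rewrite -[X in _ -> subdiff _ _ (fun_of_matrix X 0 i / _)]opprB.
by rewrite [X in _ -> subdiff _ _ (X / _)]mxE.
Qed.

(** [W k] is the error after the forward step and [P k] the error after the backward step, [xs]
    being fixed by the two combined. *)
Local Notation W k := (x k - alpha *: grad f (x k) - (xs - alpha *: grad f xs)).
Local Notation P k := (x k.+1 - xs).

(** The known subgradients at the new iterate and at [xs] differ by (W - P) / alpha, so this is
    monotonicity scaled by alpha. *)
Lemma pgm_firmly_nonexpansive k i : 0 <= (W k 0 i - P k 0 i) * P k 0 i.
Proof.
have := subdiff_monotone (g_proper i) (pgm_edom k i) (minimizer_edom i)
  (@pgm_subdiff k i) (@minimizer_subdiff i).
rewrite -(pmulr_rge0 _ alpha_gt0) mulrA; congr (_ <= _ * _); rewrite !mxE //.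
by field; rewrite gt_eqF.
Qed.

(** In w^2 = (w - p)^2 + 2 (w - p) p + p^2 the cross term is nonnegative; the residual bound below
    uses the same identity. *)
Lemma pgm_coord_le k i : `|P k 0 i| <= `|W k 0 i|.
Proof.
have := pgm_firmly_nonexpansive k i.
move: (W k 0 i) (P k 0 i) => w p h.
rewrite -ler_sqr ?nnegrE // !real_normK ?num_real //.
by have := sqr_ge0 (w - p); lra.
Qed.

Lemma pgm_residual_coord_le k i : `|W k 0 i - P k 0 i| <= `|W k 0 i|.
Proof.
have := pgm_firmly_nonexpansive k i.
move: (W k 0 i) (P k 0 i) => w p h.
rewrite -ler_sqr ?nnegrE // !real_normK ?num_real //.
by have := sqr_ge0 p; lra.
Qed.

Lemma pgm_linear_rate k : enorm (x k - xs) <= Q ^+ k * enorm (x 0%N - xs).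
Proof.
elim: k => [|k IHk]; first by rewrite expr0 mul1r.
apply: le_trans (_ : enorm (W k) <= _).
  by apply: le_enorm => i; exact: pgm_coord_le.
apply: le_trans (gradient_step_contraction mu_gt0 mu_lt_L f_sc f_lip _ _
  alpha_gt0) _.
rewrite exprS -mulrA; apply: ler_wpM2l IHk.
by rewrite le_max normr_ge0.
Qed.

(** The residual W - P is dominated by W, which the forward step has already contracted once from
    iterate k; hence the exponent k + 1. *)
Lemma pgm_subgradient_dist k i :
  `|(x k - alpha *: grad f (x k) - x k.+1) 0 i / alpha + grad f xs 0 i| <=
  Q ^+ k.+1 * enorm (x 0%N - xs) / alpha.
Proof.
have -> : (x k - alpha *: grad f (x k) - x k.+1) 0 i / alpha + grad f xs 0 i =
    (W k 0 i - P k 0 i) / alpha.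
  by rewrite !mxE; field; rewrite gt_eqF.
rewrite normrM normfV (gtr0_norm alpha_gt0) ler_pM2r ?invr_gt0 //.
apply: le_trans (pgm_residual_coord_le k i) _.
apply: le_trans (coord_le_enorm _ _) _.
apply: le_trans (gradient_step_contraction mu_gt0 mu_lt_L f_sc f_lip _ _
  alpha_gt0) _.
rewrite exprS -mulrA; apply: ler_wpM2l (pgm_linear_rate k).
by rewrite le_max normr_ge0.
Qed.

Lemma pgm_identifies k i :
  ((Q ^+ k.+1 * enorm (x 0%N - xs) / alpha)%:E < 
    mine ((- grad f xs 0 i)%:E - subdiff_lo (g i) (xs 0%R i))
         (subdiff_hi (g i) (xs 0%R i) + (grad f xs 0 i)%:E))%E ->
  x k.+1 0 i = xs 0 i.
Proof.
have := pgm_subgradient_dist k i; have := @pgm_subdiff k i.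
set u := _ / alpha; set eps := _ / alpha; set G := grad f xs 0 i => su.
rewrite ler_norml => /andP[u_lo u_hi]; rewrite lt_min => /andP[lo hi].
(* As u exceeds the infimum, some subgradient a at [xs] lies below u; the endpoint may be -oo, and
   +oo would contradict [lo]. *)
have {lo} /ereal_inf_lt[_ [a /interior_subset sa <-] au] :
    (subdiff_lo (g i) (xs 0%R i) < u%:E)%E.
  move: lo; case: (subdiff_lo _ _) => [r| |]; [|by []|by move=> _; exact: ltNyr].
  by rewrite -EFinB !lte_fin; lra.
have {hi} /ereal_sup_gt[_ [b /interior_subset sb <-] ub] :
    (u%:E < subdiff_hi (g i) (xs 0%R i))%E.
  move: hi; case: (subdiff_hi _ _) => [r| |]; [|by move=> _; exact: ltry|by []].
  by rewrite -EFinD !lte_fin; lra.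
by apply: (subdiff_between_eq (g_proper i) (pgm_edom k i) (minimizer_edom i) su
  sa sb).
Qed.

End ProximalGradient.

(** * Positivity of the gap and the iteration count *)

Lemma subdiff_gap_gt0 (R : realType) (n : nat) (f : 'rV[R]_n -> R)
    (g : 'I_n -> R -> \bar R) (xs : 'rV[R]_n) :
  nondegenerate_min f g xs -> (0 < subdiff_gap f g xs)%E.
Proof.
move=> nondeg; apply: lt_bigmin => [|i]; first exact: ltry.
rewrite inE => /(proj2 (nondeg i)) int_v.
(* A ball of radius e fits in the interior, and its points at distance e / 2 on either side of the
   center keep both endpoints away from it. *)
have : nbhs (- grad f xs 0 i) (subdiff (g i) (xs 0 i))^°.
  by apply: open_nbhs_nbhs; split => //; exact: open_interior.
move=> /nbhs_ballP[e /= e0 eB].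
have in_ball (t : R) : `|t| <= e / 2 ->
    ((EFin @` (subdiff (g i) (xs 0 i))^°) (- grad f xs 0 i + t)%:E).
  move=> te; exists (- grad f xs 0 i + t) => //; apply: eB.
  by rewrite /ball /= opprD addrA subrr add0r normrN; lra.
have e2 : `|e / 2| <= e / 2 by rewrite gtr0_norm // divr_gt0.
have v_lo : `|- (e / 2)| <= e / 2 by rewrite normrN.
rewrite lt_min sube_gt0; apply/andP; split.
  apply: le_lt_trans (ereal_inf_lbound (in_ball _ v_lo)) _.
  by rewrite lte_fin; lra.
rewrite -[grad f xs 0 i]opprK EFinN sube_gt0.
apply: lt_le_trans _ (ereal_sup_ubound (in_ball _ e2)).
by rewrite lte_fin; lra.
Qed.

(** For finite delta and D > 0, exponentiating turns the bound on m into 3 q^m D <= delta a; the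
    factor 3 supplies the strict inequality. *)
Lemma geometric_lt_gap (R : realType) (q D a : R) (delta : \bar R) (m k : nat) :
  0 < q < 1 -> 0 <= D -> 0 < a -> (0 < delta)%E ->
  ((1 / ln (1 / q))%:E * lne ((3 * D)%:E / (delta * a%:E)) <= m%:R%:E)%E ->
  (m <= k)%N -> ((q ^+ k * D / a)%:E < delta)%E.
Proof.
move=> /andP[q0 q1] D0 a0; case: delta => [d| |] //; last by move=> *; rewrite ltry.
rewrite !lte_fin ltr_pdivrMr // => d0 hm mk; have da0 := mulr_gt0 d0 a0.
(* For D = 0 the claim is 0 < d * a; otherwise the logarithm is taken of a positive real. *)
move: D0; rewrite le_eqVlt => /predU1P[<-|D0]; first by rewrite mulr0.
have X0 : 0 < 3 * D / (d * a) by rewrite divr_gt0 // mulr_gt0.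
have V0 : 0 < 1 / q by rewrite divr_gt0.
have ln0 : 0 < ln (1 / q) by rewrite ln_gt0 // ltr_pdivlMr // mul1r.
move: hm; rewrite -EFinM inver gt_eqF // -EFinM lne_EFin // -EFinM lee_fin.
rewrite [1 / ln _]div1r ler_pdivrMl // mulr_natr -lnXn //.
rewrite ler_ln ?posrE ?exprn_gt0 //.
rewrite expr_div_n expr1n ler_pdivlMr ?exprn_gt0 // mulrAC ler_pdivrMr // mul1r.
have qk : q ^+ k * D <= q ^+ m * D.
  by rewrite ler_pM2r // ler_wiXn2l // ltW.
have := exprn_gt0 m q0 => qm h; have := mulr_gt0 qm D0; lra.
Qed.

Theorem corollary2 (R : realType) (n : nat) (f : 'rV[R]_n -> R)
    (g : 'I_n -> R -> \bar R) (mu L alpha : R)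
    (xs : 'rV[R]_n) (x : nat -> 'rV[R]_n)
    (mu_gt0 : 0 < mu) (mu_lt_L : mu < L)
    (f_diff : forall y, differentiable f y)
    (f_sc : strongly_convex mu f)
    (f_lip : lipschitz_grad L f)
    (g_proper : forall i, eproper (g i))
    (g_convex : forall i, econvex (g i))
    (g_lsc : forall i, lower_semicontinuous (g i))
    (xs_min : argmin (fun y => ((f y)%:E + separable_sum g y)%E) xs)
    (xs_nondeg : nondegenerate_min f g xs)
    (alpha_gt0 : 0 < alpha) (alpha_lt : alpha < 2 / L)
    (x_pgm : proximal_gradient alpha f (separable_sum g) x) :
  let Q := contraction_factor alpha L mu in
  let delta := subdiff_gap f g xs in
  forall kbar : nat,
    ((1 / ln (1 / Q))%:E
       * lne ((3 * enorm (x 0%N - xs))%:E / (delta * alpha%:E))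
     <= (kbar%:R)%:E)%E ->
    forall k : nat, (kbar < k)%N ->
    forall i : 'I_n, active_set g xs i -> x k 0 i = xs 0 i.
Proof.
(* Iterate 0 is excluded by kbar < k, so the iterate is the output of a proximal step. *)
move=> Q delta kbar hkbar [//|k] kbar_le i Zi.
have Q_bounds : 0 < Q < 1 by exact: contraction_factor_bounds.
have := geometric_lt_gap Q_bounds (enorm_ge0 _) alpha_gt0
  (subdiff_gap_gt0 xs_nondeg) hkbar (ltnW kbar_le).
move=> small; apply: (pgm_identifies mu_gt0 mu_lt_L f_sc f_lip g_proper g_convex
  xs_min alpha_gt0 x_pgm).
apply: lt_le_trans small _.
by apply: bigmin_le_cond; rewrite inE.
Qed.
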